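(* Let $X$ and $K$ be metric spaces and fix a base point $x_0\in X$. Then the following conditions are equivalent: (a) $K$ is a large scale absolute extensor of $X$. (b) For all $M,\epsilon>0$ there are $n,R,\delta>0$ such that for any bounded subset $B$ of $X\setminus B(x_0,n)$ and any $A\subset B$, every $(\delta,R)$-continuous function $f\colon A\to K$ extends to an $(\epsilon,M)$-continuous function $g\colon B\to K$. (c) For all $M,\epsilon>0$ there are $R,\delta>0$ such that for any bounded subset $B$ of $X$ and any $A\subset B$, every $(\delta,R)$-continuous function $f\colon A\to K$ extends to an $(\epsilon,M)$-continuous function $g\colon B\to K$. (d) For all $M,\epsilon>0$ there are $R,\delta>0$ such that for any $A\subset X$, every $(\delta,R)$-continuous function $f\colon A\to K$ extends to an $(\epsilon,M)$-continuous function $g\colon X\to K$.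
   Context: Metric spaces $X$, $K$ are nonempty by convention. For $\epsilon,\delta>0$, a function $f\colon (X,d_X)\to(Y,d_Y)$ of metric spaces is $(\epsilon,\delta)$-continuous if $d_X(x,y)<\delta$ implies $d_Y(f(x),f(y))<\epsilon$ for all $x,y\in X$ (subsets carry the restricted metric). A function $f\colon X\to Y$ of metric spaces (not assumed continuous) is slowly oscillating if, for a base point $x_0\in X$ (whose choice is irrelevant), for all $R,\epsilon>0$ there is $N>0$ such that for every $x\in X$ with $d(x_0,x)>N$ the diameter of $f(B(x,R))$ is less than $\epsilon$. A metric space $K$ is a large scale absolute extensor of a metric space $X$ if for every subset $A\subset X$ and every slowly oscillating $f\colon A\to K$ there is a slowly oscillating $g\colon X\to K$ with $g|_A=f$. *)

(* Defs.v *)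
From HB Require Import structures.
From mathcomp Require Import all_boot all_order all_algebra.
From mathcomp Require Import all_classical all_reals ereal topology.

Set Implicit Arguments.
Unset Strict Implicit.
Unset Printing Implicit Defensive.

Import Order.TTheory GRing.Theory Num.Theory.

Local Open Scope classical_set_scope.
Local Open Scope ring_scope.

(* A function on a subset A of X is represented by a total function on X of
   which only the values on A matter; every definition below about a function
   on A takes A as an argument and uses the metric restricted to A.  When the
   codomain is nonempty, every function on A arises in this way. *)

(* With this formula, diam set0 = -oo. *)
Definition diam (R : realType) (T : metricType R) (S : set T) : \bar R :=
  ereal_sup [set (mdist p.1 p.2)%:E | p in S `*` S].

Definition metric_bounded (R : realType) (T : metricType R) (S : set T) : Prop :=
  (diam S < +oo)%E.

(* The argument eps bounds distances in the codomain, delta in the domain. *)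
Definition eps_delta_continuous (R : realType) (X K : metricType R)
    (eps delta : R) (A : set X) (f : X -> K) : Prop :=
  forall x y, A x -> A y -> mdist x y < delta -> mdist (f x) (f y) < eps.

(* The ball of radius r around x in the subspace A is A `&` ball x r. *)
Definition slowly_oscillating_from (R : realType) (X K : metricType R)
    (a0 : X) (A : set X) (f : X -> K) : Prop :=
  forall r eps : R, 0 < r -> 0 < eps ->
  exists N : R, 0 < N /\
    forall x, A x -> N < mdist a0 x -> (diam (f @` (A `&` ball x r)) < eps%:E)%E.

(* The base point belongs to A, so that A is nonempty; its choice is irrelevant
   by slowly_oscillating_baseP. *)
Definition slowly_oscillating (R : realType) (X K : metricType R)
    (A : set X) (f : X -> K) : Prop :=
  exists2 a0, A a0 & slowly_oscillating_from a0 A f.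

Lemma slowly_oscillating_baseP (R : realType) (X K : metricType R)
    (A : set X) (f : X -> K) (a : X) :
  A a -> slowly_oscillating A f <-> slowly_oscillating_from a A f.
Proof.
move=> Aa; split=> [[b Ab H]|H]; last by exists a.
move=> r eps r0 e0; have [N [N0 HN]] := H r eps r0 e0.
exists (N + mdist b a); split; first by rewrite ltr_wpDr // mdist_ge0.
move=> x Ax Nx; apply: HN => //; rewrite -(ltrD2r (mdist b a)).
by rewrite (lt_le_trans Nx) // addrC (metric_sym b a) metric_triangle.
Qed.

Definition large_scale_absolute_extensor (R : realType)
    (K X : metricType R) : Prop :=
  forall (A : set X) (f : X -> K), slowly_oscillating A f ->
  exists g : X -> K, slowly_oscillating [set: X] g /\ {in A, g =1 f}.

(* Main.v *)
Require Import Defs.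
From HB Require Import structures.
From mathcomp Require Import all_boot all_order all_algebra.
From mathcomp Require Import all_classical all_reals ereal topology.
From mathcomp Require Import lra.

Set Implicit Arguments.
Unset Strict Implicit.
Unset Printing Implicit Defensive.

Import Order.TTheory GRing.Theory Num.Theory.

Local Open Scope classical_set_scope.
Local Open Scope ring_scope.

(* Write u for the distance to x0.

   (a) => (b): if (b) fails, choose non-extendable functions f_k on sets A_k that
   run off to infinity and are farther and farther apart; their union is slowly
   oscillating, and a slowly oscillating extension of it extends some f_k.

   (b) => (c): f is nearly constant on a ball around x0 that is small with respect
   to its scale, so it extends by a constant to that ball and a collar of it; (b)
   extends the result to the complement of the ball.

   (c) => (d) and (d) => (a): cut X into layers t_i <= u < t_(i+1).  First extend f
   to disjoint strips t_i <= u < t_i + P_i, at a scale finer than the target one,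
   and then to each layer together with both of its bounding strips.  The
   extensions agree on the strips, and two points closer than P_i never sit on
   opposite sides of a strip, so they glue.  Constant scales give (d); scales that
   tend to infinity with i give (a). *)

(** * Scales, the extension property and slow oscillation *)

Lemma diam_leP (R : realType) (T : metricType R) (S : set T) (r : R) :
  (diam S <= r%:E)%E <-> forall x y, S x -> S y -> mdist x y <= r.
Proof.
split=> [Sr x y Sx Sy|Sr].
  rewrite -lee_fin (le_trans _ Sr)//; apply: ereal_sup_ubound.
  by exists (x, y).
by apply: ge_ereal_sup => _ [[x y] [/= Sx Sy] <-]; rewrite lee_fin; exact: Sr.
Qed.

Lemma metric_boundedP (R : realType) (T : metricType R) (x0 : T) (S : set T) :
  metric_bounded S <-> exists r : R, S `<=` [set x | mdist x0 x < r].
Proof.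
split=> [bS|[r Sr]]; last first.
  apply: (@le_lt_trans _ _ (r + r)%:E); last by rewrite ltry.
  apply/diam_leP => x y /Sr /= xr /Sr /= yr.
  by have := metric_triangle x x0 y; rewrite (metric_sym x x0); lra.
have [r Sr] : exists r : R, (diam S <= r%:E)%E.
  move: bS; rewrite /metric_bounded; case: (diam S) => [r||]// _.
    by exists r.
  by exists 0; rewrite leNye.
have [[b Sb]|S0] := pselect (S !=set0); last first.
  by exists 0 => x Sx; exfalso; apply: S0; exists x.
exists (mdist x0 b + r + 1) => x Sx /=.
by have /diam_leP /(_ b x Sb Sx) := Sr; have := metric_triangle x0 b x; lra.
Qed.

Lemma eps_delta_continuous_le (R : realType) (X K : metricType R)
    (eps delta eps' delta' : R) (A B : set X) (f : X -> K) :
  eps <= eps' -> delta' <= delta -> B `<=` A ->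
  eps_delta_continuous eps delta A f -> eps_delta_continuous eps' delta' B f.
Proof.
move=> le_eps le_delta BA fA x y Bx By xy.
apply: lt_le_trans le_eps; apply: fA; [exact: BA..|].
exact: lt_le_trans le_delta.
Qed.

(* Larger [n] is a stronger condition, so that one monotone index replaces the
   pair (epsilon, delta) in all the extension properties. *)
Definition scale_continuous (R : realType) (X K : metricType R) (n : nat)
    (A : set X) (f : X -> K) : Prop :=
  eps_delta_continuous n.+1%:R^-1 n.+1%:R A f.

Lemma scale_continuous_le (R : realType) (X K : metricType R) (m n : nat)
    (A B : set X) (f : X -> K) :
  (m <= n)%N -> B `<=` A -> scale_continuous n A f -> scale_continuous m B f.
Proof.
move=> mn BA; apply: eps_delta_continuous_le => //.
  by rewrite lef_pV2 ?posrE ?ltr0n// ler_nat.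
by rewrite ler_nat.
Qed.

Lemma scale_exists (R : realType) (eps delta : R) : 0 < eps ->
  exists n : nat, delta <= n.+1%:R /\ n.+1%:R^-1 <= eps.
Proof.
move=> eps0; have V0 : 0 < eps^-1 by rewrite invr_gt0.
have D0 := ler_norm delta; have D1 := normr_ge0 delta.
have h : 0 <= `|delta| + eps^-1 by lra.
exists (Num.bound (`|delta| + eps^-1)).
have := archi_boundP h; set n := Num.bound _ => hn.
have hS : (n%:R : R) <= n.+1%:R by rewrite ler_nat.
split; first by lra.
by rewrite -[leRHS]invrK lef_pV2 ?posrE ?ltr0n//; lra.
Qed.

Lemma scale_continuous_eps_delta (R : realType) (X K : metricType R)
    (eps delta : R) : 0 < eps ->
  exists n : nat, forall (A : set X) (f : X -> K),
    scale_continuous n A f -> eps_delta_continuous eps delta A f.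
Proof.
move=> eps0; have [n [nd ne]] := scale_exists delta eps0.
by exists n => A f; exact: eps_delta_continuous_le.
Qed.

(** Once bounded sets are enlarged to annuli or balls around [x0], conditions (b), (c) and (d) say
    that every [n] admits a [k], uniform in the outer radius, for annuli of some inner radius, for
    balls, and for [[set: X]]. *)
Definition extends_on (R : realType) (X K : metricType R) (k n : nat)
    (B : set X) : Prop :=
  forall (A : set X) (f : X -> K), A `<=` B -> scale_continuous k A f ->
  exists g : X -> K, scale_continuous n B g /\ forall x, A x -> g x = f x.

Lemma extends_on_le (R : realType) (X K : metricType R) (k k' n n' : nat)
    (B B' : set X) :
  (k <= k')%N -> (n' <= n)%N -> B' `<=` B ->
  extends_on K k n B -> extends_on K k' n' B'.
Proof.
move=> kk nn BB ext A f AB fA.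
have [|g [gB gf]] := ext A f (subset_trans AB BB); first exact: scale_continuous_le fA.
by exists g; split=> //; exact: scale_continuous_le gB.
Qed.

Lemma glue_functions (T U : Type) (P : nat -> set T) (h : nat -> T -> U) :
  (forall i j x, (i < j)%N -> P i x -> P j x -> h i x = h j x) ->
  exists g : T -> U, forall i x, P i x -> g x = h i x.
Proof.
move=> hP; have agree i j x : P i x -> P j x -> h i x = h j x.
  by have [ij|ji|->] := ltngtP i j => // Pi Pj; [exact: hP|rewrite (hP j i)].
have /choice[g gP] : forall x, exists y, forall i, P i x -> y = h i x.
  move=> x; have [[i Pi]|nP] := pselect (exists i, P i x).
    by exists (h i x) => j Pj; exact: agree.
  (* Off every [P i] the value is free; [h 0 x] avoids a default point of [U]. *)
  by exists (h 0 x) => i Pi; exfalso; apply: nP; exists i.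
by exists g => i x; exact: gP.
Qed.

(** A close pair lies in a ball around one of its points, and two points of a ball of radius [r] are
    less than [2 * r] apart. The point [x0] may lie outside [A]: moving the base point only adds a
    distance to [N]. *)
Lemma slowly_oscillatingP (R : realType) (X K : metricType R) (x0 : X)
    (A : set X) (f : X -> K) :
  slowly_oscillating A f <-> A !=set0 /\ forall n, exists N : R,
    scale_continuous n (A `&` [set x | N <= mdist x0 x]) f.
Proof.
split=> [[a Aa fA]|[[a Aa] fA]].
  split; first by exists a.
  move=> n; have n0 : 0 < n.+1%:R :> R by [].
  have [|N [N0 HN]] := fA n.+1%:R n.+1%:R^-1 n0; first by rewrite invr_gt0.
  exists (N + mdist x0 a + 1) => x y [Ax Nx] [Ay Ny] xy.
  have {}Nx : N < mdist a x.
    by have := metric_triangle x0 a x; move: Nx => /=; lra.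
  rewrite -lte_fin (le_lt_trans _ (HN x Ax Nx))//; apply: ereal_sup_ubound.
  exists (f x, f y) => //=; split; first exists x => //.
    by split=> //; rewrite ballEmdist /= mdistxx.
  by exists y => //; split=> //; rewrite ballEmdist.
exists a => // r eps r0 e0.
(* A supremum of distances below [eps] can equal [eps], hence the halving. *)
have e20 : 0 < eps / 2 by lra.
have [n [rn ne]] := scale_exists (2 * r) e20.
have [N HN] := fA n.
have D0 := mdist_ge0 x0 a; have N0 := ler_norm N; have N1 := normr_ge0 N.
exists (`|N| + mdist x0 a + r + 1); split; first by lra.
move=> x Ax Nx; apply: (@le_lt_trans _ _ (eps / 2)%:E); last by rewrite lte_fin; lra.
apply/diam_leP => _ _ [y [Ay xy] <-] [z [Az xz] <-].
rewrite ballEmdist /= in xy xz.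
have yP w : mdist x w < r -> N <= mdist x0 w.
  move=> xw; have := metric_triangle a x0 x; have := metric_triangle x0 w x.
  by rewrite (metric_sym w x) (metric_sym a x0); lra.
apply: le_trans ne; apply/ltW/HN; [by split=> //; exact: yP..|].
by have := metric_triangle y x z; rewrite (metric_sym y x); lra.
Qed.

(** * From annuli to balls *)

Lemma extends_on_annulus_ball (R : realType) (X K : metricType R) (x0 : X)
    (N : R) (k n : nat) :
  [set: K] !=set0 ->
  (forall D : R, extends_on K k n [set x : X | N <= mdist x0 x < D]) ->
  exists k', forall D : R, extends_on K k' n [set x : X | mdist x0 x < D].
Proof.
move=> [c0 _] ext.
have kn0 : 0 < (maxn k n).+1%:R^-1 :> R by rewrite invr_gt0.
(* The scale [k'] bounds the diameter of a ball that exceeds radius [N] by two margins: [n.+1%:R]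
   for the collar, then [k.+1%:R] to catch the points of [A] close to the collar. *)
have [k' [Rk' ek']] := @scale_exists R (maxn k n).+1%:R^-1
  (2 * (`|N| + n.+1%:R + k.+1%:R)) kn0.
have N0 := normr_ge0 N; have N1 := ler_norm N.
have n0 : 0 < n.+1%:R :> R by []. have k0 : 0 < k.+1%:R :> R by [].
have ek : k'.+1%:R^-1 <= k.+1%:R^-1 :> R.
  by apply: le_trans ek' _; rewrite lef_pV2 ?posrE// ler_nat ltnS leq_maxl.
have en : k'.+1%:R^-1 <= n.+1%:R^-1 :> R.
  by apply: le_trans ek' _; rewrite lef_pV2 ?posrE// ler_nat ltnS leq_maxr.
exists k' => D A f AD fA.
(* [c] is a value of [f] in that ball, or the default [c0] if [A] misses the ball. *)
have [c cP] : exists c : K, forall x, A x ->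
    mdist x0 x < `|N| + n.+1%:R + k.+1%:R -> mdist (f x) c < k'.+1%:R^-1.
  have [[a [Aa ra]]|nA] := pselect (exists a, A a /\
      mdist x0 a < `|N| + n.+1%:R + k.+1%:R).
    exists (f a) => x Ax rx; apply: fA => //.
    by have := metric_triangle x x0 a; rewrite (metric_sym x x0); lra.
  by exists c0 => x Ax rx; exfalso; apply: nA; exists x.
pose f' x := if x \in A then f x else c.
have f'A x : A x -> f' x = f x by move=> Ax; rewrite /f' mem_set.
have f'c x : ~ A x -> f' x = c by move=> Ax; rewrite /f' memNset.
have close x y : (A x -> mdist x0 x < `|N| + n.+1%:R + k.+1%:R) ->
    (A y -> mdist x0 y < `|N| + n.+1%:R + k.+1%:R) ->
    mdist (f' x) (f' y) < k'.+1%:R^-1.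
  have [Ax|Ax] := pselect (A x); have [Ay|Ay] := pselect (A y);
    rewrite ?(f'A _ Ax) ?(f'A _ Ay) ?(f'c _ Ax) ?(f'c _ Ay) => rx ry.
  - apply: fA => //; move: (rx Ax) (ry Ay) => {}rx {}ry.
    by have := metric_triangle x x0 y; rewrite (metric_sym x x0); lra.
  - exact: cP (rx Ax).
  - by rewrite metric_sym; exact: cP (ry Ay).
  - by rewrite mdistxx invr_gt0.
(* [f'] is [f] on [A] and the constant [c] on a collar of the ball, where it
   varies by less than [k'.+1%:R^-1]. *)
pose A' := [set x | N <= mdist x0 x < D] `&`
  (A `|` [set x | mdist x0 x < `|N| + n.+1%:R]).
have [|x y [_ Ax] [_ Ay] xy|g [gB gf]] := ext D A' f'.
- by move=> x [].
- have [[Ax' Ay']|nA] := pselect (A x /\ A y).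
    rewrite !f'A//; apply: lt_le_trans ek; apply: fA => //.
    by apply: lt_le_trans xy _; lra.
  apply: lt_le_trans ek; apply: close => [Ax'|Ay'].
    case: Ay => [Ay|/= yN]; first by exfalso; apply: nA.
    by have := metric_triangle x0 y x; rewrite (metric_sym y x); lra.
  case: Ax => [Ax|/= xN]; first by exfalso; apply: nA.
  by have := metric_triangle x0 x y; lra.
pose h x := if mdist x0 x < N then f' x else g x.
have hf' x : mdist x0 x < D -> A x \/ mdist x0 x < `|N| + n.+1%:R -> h x = f' x.
  move=> xD xA; rewrite /h; case: ifPn => //; rewrite -leNgt => Nx.
  by apply: gf; split=> //=; rewrite Nx.
exists h; split; last by move=> x Ax; rewrite hf' ?f'A//; [exact: AD|left].
(* A point within [n.+1%:R] of the ball of radius [N] falls in the collar, where [h] is still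
   [f']. *)
have near x y : mdist x0 x < D -> mdist x0 y < D -> mdist x y < n.+1%:R ->
    mdist x0 x < N -> mdist (h x) (h y) < n.+1%:R^-1.
  move=> xD yD xy xN; have := metric_triangle x0 x y => lip.
  rewrite !hf'//; [|by right; lra..].
  by apply: lt_le_trans en; apply: close => _; lra.
move=> x y /= xD yD xy.
have [xN|Nx] := ltP (mdist x0 x) N; first exact: near.
have [yN|Ny] := ltP (mdist x0 y) N.
  by rewrite metric_sym; apply: near => //; rewrite metric_sym.
rewrite /h (ltNge (mdist x0 x)) (ltNge (mdist x0 y)) Nx Ny /=.
by apply: gB => //=; rewrite ?Nx ?Ny.
Qed.

(** * Gluing extensions over layers *)

(** Each of two successive extensions costs one [F]: from [F (F (m i))] to [F (m i)] on the strips,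
    then to [m i] on the layers. The spacing of [t] leaves room for a strip of width
    [(F (m i)).+1%:R] and a gap of at least that width before the next strip. *)
Lemma extend_layers (R : realType) (X K : metricType R) (x0 : X)
    (F m : nat -> nat) (t : nat -> R) (A : set X) (f : X -> K) :
  (forall n (D : R), extends_on K (F n) n [set x : X | mdist x0 x < D]) ->
  {homo F : i j / (i <= j)%N} -> (forall n, (n <= F n)%N) ->
  {homo m : i j / (i <= j)%N} ->
  (forall i, t i + 2 * (F (m i)).+1%:R <= t i.+1) ->
  (forall i, scale_continuous (F (F (m i)))
    (A `&` [set x | t i - (F (m i)).+1%:R <= mdist x0 x]) f) ->
  exists g : X -> K,
    (forall i, scale_continuous (m i) [set x | t i <= mdist x0 x] g) /\
    forall x, A x -> g x = f x.
Proof.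
move=> extF homoF leF homom tS fA.
pose p i := F (m i); pose P i : R := (p i).+1%:R; pose u x := mdist x0 x.
have P1 i : 1 <= P i by rewrite ler1n.
have homoP i j : (i <= j)%N -> P i <= P j.
  by move=> ij; rewrite ler_nat ltnS; apply/homoF/homom.
have homot i j : (i <= j)%N -> t i <= t j.
  apply: (homo_leq (f := t) (r := fun x y => x <= y)) => // [y x z|k].
    exact: le_trans.
  by have := tS k; have := P1 k; rewrite /P /p; lra.
pose S i := [set x | t i <= u x < t i + P i].
(* The margin [P i] on both sides makes [N i] contain every point closer than [P i] to [S i]. *)
pose N i := [set x | t i - P i <= u x < t i + 2 * P i].
pose T i := [set x | t i <= u x < t i.+1 + P i.+1].
have SN i : S i `<=` N i.
  move=> x /andP[? ?]; have := P1 i; rewrite /N /= => ?.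
  by apply/andP; split; lra.
(* Extend [f] to each strip [S i] through its neighbourhood [N i]. *)
have /choice[g gP] : forall i, exists g, scale_continuous (p i) (N i) g /\
    forall x, (A `&` N i) x -> g x = f x.
  move=> i; apply: (@extends_on_le _ _ _ (F (p i)) (F (p i)) (p i) (p i)
      [set x | mdist x0 x < t i + 2 * P i]) => //.
  - by move=> x /andP[].
  - by apply: scale_continuous_le (fA i) => // x [Ax /andP[]].
have [f0 f0P] : exists f0 : X -> K, forall i x, S i x -> f0 x = g i x.
  apply: glue_functions => i j x ij /andP[ix xi] /andP[jx xj].
  have := homot _ _ ij; have := tS i; have := P1 i; rewrite /P /p in xi * => *.
  by exfalso; lra.
pose f1 x := if x \in A then f x else f0 x.
have f1A x : A x -> f1 x = f x by move=> Ax; rewrite /f1 mem_set.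
have f1S i x : S i x -> f1 x = g i x.
  move=> Sx; have [Ax|Ax] := pselect (A x); last by rewrite /f1 memNset//; exact: f0P.
  by rewrite f1A// (gP i).2//; split=> //; exact: SN.
have f1g i x : A x \/ S i x -> N i x -> f1 x = g i x.
  by move=> [Ax|Sx] Nx; [rewrite f1A// (gP i).2|exact: f1S].
pose A' i := (A `|` S i `|` S i.+1) `&` T i.
have f1cont i : scale_continuous (p i) (A' i) f1.
  (* A close pair with a point in [S j] lies in [N j], where [f1] is [g j] at both points. *)
  have near j x y : i = j \/ i.+1 = j -> T i x -> T i y -> S j x -> A y \/ S j y ->
      mdist x y < P i -> mdist (f1 x) (f1 y) < (p i).+1%:R^-1.
    move=> ij Tx Ty Sx ASy xy.
    have {}ij : (i <= j)%N by case: ij => <-.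
    have Ny : N j y.
      move: Sx => /andP[jx xj]; have := homoP _ _ ij.
      have := metric_triangle x0 x y; have := metric_triangle x0 y x.
      by rewrite (metric_sym y x) /N /= -/(u x) -/(u y) => *; apply/andP; split; lra.
    rewrite (f1S j)// (f1g j)//; have [gN _] := gP j.
    have {}gN : scale_continuous (p i) (N j) (g j).
      by apply: scale_continuous_le gN => //; apply/homoF/homom.
    by apply: gN => //; exact: SN.
  (* The gap between the two strips has width at least [P i]. *)
  have far x y : S i x -> S i.+1 y -> mdist x y < P i -> False.
    move=> /andP[ix xi] /andP[iy yi]; have := metric_triangle x0 x y; have := tS i.
    by rewrite -/(u x) -/(u y) -/(p i) -/(P i); lra.
  move=> x y [ASx Tx] [ASy Ty] xy; have yx := xy; rewrite metric_sym in yx.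
  have [[Ax Ay]|nA] := pselect (A x /\ A y).
    rewrite !f1A//; move: Tx Ty => /andP[tx _] /andP[ty _].
    have := P1 i; rewrite /P => P1i.
    apply: (scale_continuous_le (leF _) (@subset_refl _ _) (fA i)) xy.
      by split=> //=; rewrite -/(u x) -/(p i); lra.
    by split=> //=; rewrite -/(u y) -/(p i); lra.
  case: ASx => [[Ax|Sx]|Sx]; case: ASy => [[Ay|Sy]|Sy].
  - by exfalso; apply: nA.
  - by rewrite metric_sym; apply: (near i) => //; left.
  - by rewrite metric_sym; apply: (near i.+1) => //; [right|left].
  - by apply: (near i) => //; left.
  - by apply: (near i) => //; [left|right].
  - by exfalso; exact: far xy.
  - by apply: (near i.+1) => //; [right|left].
  - by exfalso; exact: far yx.
  - by apply: (near i.+1) => //; right.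
(* Extend [f1] to each layer [T i]; consecutive layers overlap in a strip. *)
have /choice[h hP] : forall i, exists h, scale_continuous (m i) (T i) h /\
    forall x, A' i x -> h x = f1 x.
  move=> i; apply: (@extends_on_le _ _ _ (p i) (p i) (m i) (m i)
      [set x | mdist x0 x < t i.+1 + P i.+1]) => //.
  - by move=> x /andP[].
  - exact: extF.
  - exact: subIsetr.
have [h0 h0P] : exists h0 : X -> K, forall i x, T i x -> h0 x = h i x.
  apply: glue_functions => i j x ij Tix Tjx.
  have Six : S i.+1 x.
    move: Tix Tjx => /andP[_ xi] /andP[jx _]; have := homot _ _ ij.
    by rewrite /S /= -/(u x) => *; apply/andP; split; lra.
  rewrite (hP i).2; last by split=> //; right.
  have [ji|ji] := eqVneq i.+1 j.
    by rewrite (hP j).2//; split=> //; rewrite -ji; left; right.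
  exfalso; have {ji}ij : (i.+2 <= j)%N by rewrite ltn_neqAle ji.
  move: Six Tjx => /andP[_ xi] /andP[jx _]; have := homot _ _ ij.
  by have := tS i.+1; have := P1 i.+1; rewrite /P /p in xi *; lra.
pose k x := if x \in A then f x else h0 x.
have kA x : A x -> k x = f x by move=> Ax; rewrite /k mem_set.
have kh i x : T i x -> k x = h i x.
  move=> Tx; have [Ax|Ax] := pselect (A x); last by rewrite /k memNset//; exact: h0P.
  by rewrite kA// (hP i).2 ?f1A//; split=> //; left; left.
exists k; split=> // i.
have unbounded x : exists j, u x < t j.
  have t_ge j : t 0 + j%:R <= t j.
    elim: j => [|j IH]; first by rewrite addr0.
    by have := tS j; have := P1 j; rewrite /P /p -natr1; lra.
  have := archi_boundP (normr_ge0 (u x - t 0)); set j := Num.bound _ => xj.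
  exists j; apply: lt_le_trans (t_ge j).
  by have := ler_norm (u x - t 0); lra.
(* Take the last [t j] that is at most [u x]: since [T j] reaches [P j.+1] beyond [t j.+1], it
   contains [y] too. *)
have main x y : t i <= u x -> u x <= u y -> mdist x y < (m i).+1%:R ->
    mdist (k x) (k y) < (m i).+1%:R^-1.
  move=> ix xy dxy; have := unbounded x; case/ex_minnP => -[|j] xj jmin.
    by exfalso; have := homot 0 i (leq0n _); lra.
  have ij : (i <= j)%N.
    rewrite leqNgt; apply/negP => /homot; have := xj; lra.
  have jx : t j <= u x.
    by rewrite leNgt; apply/negP => /jmin; rewrite ltnn.
  have mP : (m i).+1%:R <= P j.+1.
    rewrite ler_nat ltnS; apply: leq_trans (leF _) _.
    by apply/homoF/homom/(leq_trans ij).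
  have PP := P1 j.+1.
  have lip := metric_triangle x0 x y; rewrite -/(u x) -/(u y) in lip.
  have Tx : T j x by rewrite /T /= jx /=; lra.
  have Ty : T j y by rewrite /T /=; apply/andP; split; lra.
  rewrite !(kh j)//.
  by apply: (scale_continuous_le (homom _ _ ij) (@subset_refl _ _) (hP j).1) dxy.
move=> x y /= ix iy xy; have [xley|yltx] := leP (u x) (u y); first exact: main.
by rewrite metric_sym; apply: main => //; [exact: ltW|rewrite metric_sym].
Qed.

(** * From absolute extensors to extension on annuli *)

(** One [k] serves as inner radius and as input scale, so counterexamples for growing [k] both
    escape to infinity and oscillate less and less. *)
Lemma extensor_extends_on_annulus (R : realType) (X K : metricType R) (x0 : X) :
  [set: K] !=set0 -> large_scale_absolute_extensor K X ->
  forall n, exists k, forall D : R,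
    extends_on K k n [set x : X | k%:R <= mdist x0 x < D].
Proof.
move=> [c _] ext n; apply: contrapT => nk.
have /choice[w wP] : forall k, exists w : R * (set X * (X -> K)),
    [/\ w.2.1 `<=` [set x | k%:R <= mdist x0 x < w.1],
        scale_continuous k w.2.1 w.2.2 &
        forall g, scale_continuous n [set x | k%:R <= mdist x0 x < w.1] g ->
          ~ forall x, w.2.1 x -> g x = w.2.2 x].
  move=> k; apply: contrapT => nw; apply: nk; exists k => D A f AD fA.
  apply: contrapT => ng; apply: nw; exists (D, (A, f)); split=> //= g gD gf.
  by apply: ng; exists g.
pose D k := (w k).1; pose A k := (w k).2.1; pose f k := (w k).2.2.
(* The sets [A (kk j)] are bounded, and farther and farther apart. *)
pose kk := fix kk j :=
  if j is i.+1 then (Num.bound `|D (kk i)| + kk i + i.+1)%N else 0%N.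
(* [Num.bound] clears the outer radius [D (kk i)], the summand [kk i] makes [kk] monotone, and
   [i.+1] is the gap and forces [kk] to infinity. *)
have kkS i : kk i.+1 = (Num.bound `|D (kk i)| + kk i + i.+1)%N by [].
have homokk i j : (i <= j)%N -> (kk i <= kk j)%N.
  apply: (homo_leq (f := kk) (r := leq)) => // [y x z|{}i]; first exact: leq_trans.
  by rewrite kkS -addnA addnCA leq_addr.
have kk_ge j : (j <= kk j)%N.
  by case: j => // j; rewrite kkS leq_addl.
have sep i j : (i < j)%N -> D (kk i) + i.+1%:R <= (kk j)%:R.
  move=> /homokk ij; have {}ij : ((kk i.+1)%:R : R) <= (kk j)%:R by rewrite ler_nat.
  apply: le_trans ij; rewrite kkS !natrD.
  have := archi_boundP (normr_ge0 (D (kk i))); have := ler_norm (D (kk i)).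
  by have := ler0n R (kk i); lra.
have AD j x : A (kk j) x -> (kk j)%:R <= mdist x0 x /\ mdist x0 x < D (kk j).
  by move=> Ax; have [+ _ _] := wP (kk j) => /(_ x Ax) /andP[].
have disj i j x y : (i < j)%N -> A (kk i) x -> A (kk j) y -> i.+1%:R <= mdist x y.
  move=> ij /AD[_ xD] /AD[yk _].
  by have := sep _ _ ij; have := metric_triangle x0 x y; lra.
have [f0 f0P] : exists f0 : X -> K, forall i x, A (kk i) x -> f0 x = f (kk i) x.
  apply: glue_functions => i j x ij Ai Aj.
  by have := disj _ _ _ _ ij Ai Aj; rewrite mdistxx lern0.
have [|g [/(slowly_oscillatingP x0)[_ gosc] gf]] := ext (\bigcup_j A (kk j)) f0.
  apply/(slowly_oscillatingP x0); split.
    (* If the union were empty, so would be [A (kk 0)], and the constant [c] would extend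
       [f (kk 0)]. *)
    apply: contrapT => A0; have [_ _] := wP (kk 0%N); apply; last first.
      move=> x Ax; exfalso; apply: A0; exists x; exists 0%N => //; exact: Ax.
    by move=> x y _ _ _; instantiate (1 := fun=> c); rewrite mdistxx invr_gt0.
  (* Beyond radius [kk m] only sets of index at least [m] occur, and distinct ones are at least
     [m.+1%:R] apart, so a close pair lies in a single set. *)
  move=> m; exists (kk m)%:R => x y [[i _ Ax] /= mx] [[j _ Ay] /= my] xy.
  have idx l z : A (kk l) z -> (kk m)%:R <= mdist x0 z -> (m <= l)%N.
    move=> Az mz; rewrite leqNgt; apply/negP => lm.
    have [_ zD] := AD _ _ Az; have := sep _ _ lm; have := ler0n R l.+1; lra.
  have mi := idx _ _ Ax mx; have mj := idx _ _ Ay my.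
  have far a b l l' : (l < l')%N -> (m <= l)%N -> A (kk l) a -> A (kk l') b ->
      mdist a b < m.+1%:R -> False.
    move=> ll ml Aa Ab ab; have := disj _ _ _ _ ll Aa Ab.
    have : (m.+1%:R : R) <= l.+1%:R by rewrite ler_nat.
    by lra.
  have [ij|ji|ij] := ltngtP i j.
  - by exfalso; exact: (far _ _ _ _ ij mi Ax Ay xy).
  - by exfalso; apply: (far _ _ _ _ ji mj Ay Ax); rewrite metric_sym.
  rewrite -{j}ij in mj Ay *; rewrite !(f0P i)//.
  have [_ fi _] := wP (kk i).
  by apply: (scale_continuous_le (leq_trans mi (kk_ge i)) (@subset_refl _ _) fi).
have [N gN] := gosc n.
(* For this [j] the annulus of the counterexample lies where [g] is continuous at scale [n]. *)
pose j := Num.bound `|N|.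
have Nj : N <= (kk j)%:R.
  have := archi_boundP (normr_ge0 N); rewrite -/j; have := ler_norm N.
  have : (j%:R : R) <= (kk j)%:R by rewrite ler_nat.
  by lra.
have [_ _ noext] := wP (kk j); apply: (noext g).
  apply: scale_continuous_le gN => // x /andP[xk _]; split=> //=.
  exact: le_trans xk.
by move=> x Ax; rewrite gf ?(f0P j)//; apply/mem_set; exists j.
Qed.

(** * From balls to the whole space, and on to absolute extensors *)

(** Upward closure in [k] allows replacing a choice function by [n] plus its partial sums, which has
    the monotonicity and growth that [extend_layers] requires. *)
Lemma monotone_choice (P : nat -> nat -> Prop) :
  (forall n k k', (k <= k')%N -> P k n -> P k' n) ->
  (forall n, exists k, P k n) ->
  exists F : nat -> nat, [/\ forall n, P (F n) n,
    {homo F : i j / (i <= j)%N} & forall n, (n <= F n)%N].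
Proof.
move=> Pmono /choice[F PF].
exists (fun n => n + \sum_(i < n.+1) F i)%N; split=> [n|i j ij|n].
- apply: Pmono (PF n); rewrite big_ord_recr /= addnCA.
  exact: leq_trans (leq_addl _ _) (leq_addl _ _).
- rewrite leq_add// -!(big_mkord xpredT F) (@big_cat_nat _ _ _ i.+1 0%N j.+1)//=.
  exact: leq_addr.
- by rewrite leq_addr.
Qed.

Lemma extends_on_ball_total (R : realType) (X K : metricType R) (x0 : X) :
  (forall n, exists k, forall D : R, extends_on K k n [set x : X | mdist x0 x < D]) ->
  forall n, exists k, extends_on K k n [set: X].
Proof.
move=> /monotone_choice[n k k' kk ext D|F [extF homoF leF] n].
  exact: (extends_on_le kk (leqnn _) (@subset_refl _ _) (ext D)).
exists (F (F n)) => A f _ fA.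
pose P : R := (F n).+1%:R.
have P0 : 0 <= P by [].
(* Layers of equal width [2 * P] start at [0], so the estimate for layer [0] already covers [X]. *)
have [//|i|i|g [gn gf]] := @extend_layers _ _ _ x0 F (fun=> n)
  (fun i => i%:R * (2 * P)) A f extF homoF leF.
- by rewrite -(natr1 i) [leRHS]mulrDl mul1r lexx.
- by apply: scale_continuous_le fA => // x [].
exists g; split=> //; apply: scale_continuous_le (gn 0%N) => // x _ /=.
by rewrite mul0r mdist_ge0.
Qed.

Lemma extends_on_total_extensor (R : realType) (X K : metricType R) :
  (forall n, exists k, extends_on K k n [set: X]) ->
  large_scale_absolute_extensor K X.
Proof.
move=> /monotone_choice[n k k' kk|F [extF homoF leF] A f].
  exact: (extends_on_le kk (leqnn _) (@subset_refl _ _)).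
move=> fosc; have [x0 _ _] := fosc.
have /(slowly_oscillatingP x0)[[a Aa] fA] := fosc.
have /choice[N NP] := fun i => fA (F (F i)).
pose P i : R := (F i).+1%:R.
(* The last summand gives [N i <= t i - P i]; as [P] is monotone, the increments are at least
   [2 * P i]. *)
pose t i := \sum_(j < i.+1) (`|N j| + 2 * P j).
have P0 i : 0 <= P i by [].
have [||i|i|g [gn gf]] := @extend_layers _ X K x0 F id t A f _ homoF leF.
- move=> n D; exact: (extends_on_le (leqnn _) (leqnn _) (@subsetT _ _) (extF n)).
- by [].
- rewrite /t [leRHS]big_ord_recr /= lerD2l.
  have : P i <= P i.+1 by rewrite ler_nat ltnS; apply: homoF.
  by have := normr_ge0 (N i.+1); rewrite -/(P i); lra.
- apply: scale_continuous_le (NP i) => // x [Ax /= xt]; split=> //=.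
  apply: le_trans xt; rewrite /t big_ord_recr /= -/(P i).
  have : 0 <= \sum_(j < i) (`|N j| + 2 * P j).
    by apply: sumr_ge0 => j _; rewrite addr_ge0 ?mulr_ge0.
  by have := ler_norm (N i); have := P0 i; lra.
exists g; split; last by move=> x /set_mem; exact: gf.
apply/(slowly_oscillatingP x0); split; first by exists x0.
by move=> n; exists (t n); rewrite setTI; exact: gn.
Qed.

(** * The cycle of implications between the four conditions *)

Theorem theorem4p6 (R : realType) (X K : metricType R) (x0 : X)
    (K_nonempty : [set: K] !=set0) :
  [<-> (* (a) *)
       large_scale_absolute_extensor K X;
       (* (b) *)
       forall M eps : R, 0 < M -> 0 < eps ->
       exists n r delta : R, [/\ 0 < n, 0 < r, 0 < delta &
         forall B : set X, metric_bounded B -> B `<=` ~` ball x0 n ->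
         forall A : set X, A `<=` B ->
         forall f : X -> K, eps_delta_continuous delta r A f ->
         exists g : X -> K, eps_delta_continuous eps M B g /\ {in A, g =1 f}];
       (* (c) *)
       forall M eps : R, 0 < M -> 0 < eps ->
       exists r delta : R, [/\ 0 < r, 0 < delta &
         forall B : set X, metric_bounded B ->
         forall A : set X, A `<=` B ->
         forall f : X -> K, eps_delta_continuous delta r A f ->
         exists g : X -> K, eps_delta_continuous eps M B g /\ {in A, g =1 f}];
       (* (d) *)
       forall M eps : R, 0 < M -> 0 < eps ->
       exists r delta : R, [/\ 0 < r, 0 < delta &
         forall (A : set X) (f : X -> K), eps_delta_continuous delta r A f ->
         exists g : X -> K,
           eps_delta_continuous eps M [set: X] g /\ {in A, g =1 f}]].
Proof.
have scale_gt0 n : 0 < n.+1%:R :> R /\ 0 < n.+1%:R^-1 :> R by rewrite invr_gt0.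
tfae.
- move=> /(extensor_extends_on_annulus x0 K_nonempty) ext M eps M0 eps0.
  have [n nP] := scale_continuous_eps_delta X K M eps0.
  have [k extk] := ext n; have [k0 kV0] := scale_gt0 k.
  (* The radius is [k.+1] rather than [k] because (b) asks for a positive one and [k] may be [0]. *)
  exists k.+1%:R, k.+1%:R, k.+1%:R^-1; split=> // B /(metric_boundedP x0)[D BD] Bk A AB f fA.
  have kB : B `<=` [set x | k%:R <= mdist x0 x < D].
    move=> x Bx /=; apply/andP; split; last exact: BD.
    move: (Bk x Bx); rewrite ballEmdist /= => /negP; rewrite -leNgt; apply: le_trans.
    by rewrite ler_nat.
  have [g [gB gf]] := extends_on_le (leqnn k) (leqnn n) kB (extk D) AB fA.
  by exists g; split; [exact: nP|move=> x /set_mem; exact: gf].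
- move=> ext.
  have extc : forall n, exists k, forall D : R,
      extends_on K k n [set x : X | mdist x0 x < D].
    move=> n; have [n0 nV0] := scale_gt0 n.
    have [N [r [delta [N0 r0 delta0 extN]]]] := ext _ _ n0 nV0.
    have [k kP] := scale_continuous_eps_delta X K r delta0.
    apply: (@extends_on_annulus_ball _ _ _ x0 N k n) => // D A f AD fA.
    have [||g [gB gf]] := extN _ _ _ A AD f (kP _ _ fA).
    + by apply/(metric_boundedP x0); exists D => x /andP[].
    + by move=> x /andP[Nx _]; rewrite ballEmdist /=; apply/negP; rewrite -leNgt.
    by exists g; split=> // x Ax; apply/gf/mem_set.
  move=> M eps M0 eps0.
  have [n nP] := scale_continuous_eps_delta X K M eps0.
  have [k extk] := extc n; have [k0 kV0] := scale_gt0 k.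
  exists k.+1%:R, k.+1%:R^-1; split=> // B /(metric_boundedP x0)[D BD] A AB f fA.
  have [g [gB gf]] := extends_on_le (leqnn k) (leqnn n) BD (extk D) AB fA.
  by exists g; split; [exact: nP|move=> x /set_mem; exact: gf].
- move=> ext.
  have extc : forall n, exists k, forall D : R,
      extends_on K k n [set x : X | mdist x0 x < D].
    move=> n; have [n0 nV0] := scale_gt0 n.
    have [r [delta [r0 delta0 extN]]] := ext _ _ n0 nV0.
    have [k kP] := scale_continuous_eps_delta X K r delta0.
    exists k => D A f AD fA.
    have [|g [gB gf]] := extN _ _ A AD f (kP _ _ fA).
      by apply/(metric_boundedP x0); exists D.
    by exists g; split=> // x Ax; apply/gf/mem_set.
  move=> M eps M0 eps0.
  have [n nP] := scale_continuous_eps_delta X K M eps0.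
  have [k extk] := extends_on_ball_total extc n; have [k0 kV0] := scale_gt0 k.
  exists k.+1%:R, k.+1%:R^-1; split=> // A f fA.
  have [g [gB gf]] := extk A f (@subsetT _ _) fA.
  by exists g; split; [exact: nP|move=> x /set_mem; exact: gf].
- move=> ext; apply: extends_on_total_extensor => n.
  have [n0 nV0] := scale_gt0 n.
  have [r [delta [r0 delta0 extN]]] := ext _ _ n0 nV0.
  have [k kP] := scale_continuous_eps_delta X K r delta0.
  exists k => A f _ fA; have [g [gB gf]] := extN A f (kP _ _ fA).
  by exists g; split=> // x Ax; apply/gf/mem_set.
Qed.
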